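(* Let $(X,d,W)$ be a complete $UCW$-hyperbolic space with a monotone modulus of uniform convexity $\eta$, $C\subseteq X$ a nonempty convex closed bounded subset with finite diameter $d_C$ and $T:C\to C$ nonexpansive. Let $(\lambda_n),(s_n)$ be sequences in $[0,1]$ such that $\sum_{n=0}^\infty\lambda_n(1-\lambda_n)$ diverges with rate of divergence $\theta:\mathbb{N}\to\mathbb{N}$, $\limsup_n s_n<1$ with $L,N_0\in\mathbb{N}$ ($L\ge1$) such that $s_n\le1-\frac1L$ for all $n\ge N_0$, and $\sum_{n=0}^\infty s_n(1-\lambda_n)$ converges with Cauchy modulus $\gamma$. For $x\in C$ let $(x_n)$ be the Ishikawa iteration starting with $x$. Then $\lim_{n\to\infty}d(x_n,Tx_n)=0$ for all $x\in C$ and, moreover, if $d_C>0$, then for all $x\in C$, $$\forall\varepsilon>0\ \forall n\ge\Phi(\varepsilon,\eta,d_C,\theta,L,N_0,\gamma)\ \big(d(x_n,Tx_n)<\varepsilon\big),$$ where $$\Phi(\varepsilon,\eta,d_C,\theta,L,N_0,\gamma):=\begin{cases}\theta\left(\left\lceil\dfrac{2L(d_C+1)}{\varepsilon\cdot\eta\left(d_C,\frac{\varepsilon}{2Ld_C}\right)}\right\rceil+\gamma\left(\dfrac{\varepsilon}{8d_C}\right)+N_0+1\right)&\text{for }\varepsilon\le4Ld_C,\\[2mm]\gamma\left(\dfrac{\varepsilon}{8d_C}\right)+N_0+1&\text{otherwise.}\end{cases}$$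
   Context: A $W$-hyperbolic space $(X,d,W)$ is a metric space $(X,d)$ with a map $W:X\times X\times[0,1]\to X$ such that for all $x,y,z,w\in X$, $\lambda,\tilde\lambda\in[0,1]$: (W1) $d(z,W(x,y,\lambda))\le(1-\lambda)d(z,x)+\lambda d(z,y)$; (W2) $d(W(x,y,\lambda),W(x,y,\tilde\lambda))=|\lambda-\tilde\lambda|\,d(x,y)$; (W3) $W(x,y,\lambda)=W(y,x,1-\lambda)$; (W4) $d(W(x,z,\lambda),W(y,w,\lambda))\le(1-\lambda)d(x,y)+\lambda d(z,w)$. Write $(1-\lambda)x\oplus\lambda y:=W(x,y,\lambda)$. A nonempty $C\subseteq X$ is convex if $(1-\lambda)x\oplus\lambda y\in C$ for all $x,y\in C$, $\lambda\in[0,1]$. $(X,d,W)$ is uniformly convex with modulus of uniform convexity $\eta:(0,\infty)\times(0,2]\to(0,1]$ if for all $r>0$, $\varepsilon\in(0,2]$, $a,x,y\in X$: $d(x,a)\le r$, $d(y,a)\le r$, $d(x,y)\ge\varepsilon r$ imply $d(\frac12x\oplus\frac12y,a)\le(1-\eta(r,\varepsilon))r$. The modulus $\eta$ is monotone if it decreases with $r$ for fixed $\varepsilon$ (i.e. $\eta(s,\varepsilon)\le\eta(r,\varepsilon)$ whenever $s\ge r$). A $UCW$-hyperbolic space is a uniformly convex $W$-hyperbolic space admitting a monotone modulus of uniform convexity. $T:C\to C$ is nonexpansive if $d(Tx,Ty)\le d(x,y)$ for all $x,y\in C$. The Ishikawa iteration starting with $x\in C$ is $x_0:=x$, $x_{n+1}:=(1-\lambda_n)x_n\oplus\lambda_nT((1-s_n)x_n\oplus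 s_nTx_n)$. $\mathbb{N}$ includes $0$. A rate of divergence of a divergent series $\sum_{n=0}^\infty a_n$ is a function $\theta:\mathbb{N}\to\mathbb{N}$ with $\sum_{i=0}^{\theta(n)}a_i\ge n$ for all $n\in\mathbb{N}$. A Cauchy modulus of a convergent series $\sum_{n=0}^\infty a_n$ is a function $\gamma:(0,\infty)\to\mathbb{N}$ such that the partial sums $\sigma_n:=\sum_{i=0}^na_i$ satisfy $|\sigma_{\gamma(\varepsilon)+n}-\sigma_{\gamma(\varepsilon)}|<\varepsilon$ for all $\varepsilon>0$, $n\in\mathbb{N}$. *)

(* Defs.v *)
From HB Require Import structures.
From mathcomp Require Import all_boot all_order all_algebra.
From mathcomp Require Import all_classical all_reals all_analysis.

Set Implicit Arguments.
Unset Strict Implicit.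
Unset Printing Implicit Defensive.

Import Order.TTheory GRing.Theory Num.Theory.
Import numFieldNormedType.Exports.

Local Open Scope classical_set_scope.
Local Open Scope ring_scope.

#[short(type="completeMetricType")]
HB.structure Definition CompleteMetric (K : numDomainType) :=
  { M of Metric K M & Complete M }.

(* [W x y l] is the point (1 - l) x (+) l y.  The parameter ranges over all of
   [R], but [W] is only constrained, and only used, for parameters in [0, 1]. *)
Record W_hyperbolic (R : realType) (X : metricType R) (W : X -> X -> R -> X)
    : Prop := {
  W_dist_le : forall (x y z : X) (l : R), 0 <= l <= 1 ->
    mdist z (W x y l) <= (1 - l) * mdist z x + l * mdist z y ;
  W_dist_param : forall (x y : X) (l l' : R), 0 <= l <= 1 -> 0 <= l' <= 1 ->
    mdist (W x y l) (W x y l') = `|l - l'| * mdist x y ;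
  W_sym : forall (x y : X) (l : R), 0 <= l <= 1 -> W x y l = W y x (1 - l) ;
  W_dist_W : forall (x y z w : X) (l : R), 0 <= l <= 1 ->
    mdist (W x z l) (W y w l) <= (1 - l) * mdist x y + l * mdist z w
}.

Definition W_convex (R : realType) (X : metricType R) (W : X -> X -> R -> X)
    (C : set X) : Prop :=
  forall (x y : X) (l : R), C x -> C y -> 0 <= l <= 1 -> C (W x y l).

(* A modulus eta : (0, oo) x (0, 2] -> (0, 1] is encoded as a total function
   whose values outside (0, oo) x (0, 2] are irrelevant. *)
Definition modulus_of_uniform_convexity (R : realType) (X : metricType R)
    (W : X -> X -> R -> X) (eta : R -> R -> R) : Prop :=
  (forall r e : R, 0 < r -> 0 < e <= 2 -> 0 < eta r e <= 1) /\
  (forall (r e : R) (a x y : X), 0 < r -> 0 < e <= 2 ->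
     mdist x a <= r -> mdist y a <= r -> e * r <= mdist x y ->
     mdist (W x y 2^-1) a <= (1 - eta r e) * r).

Definition monotone_modulus (R : realType) (eta : R -> R -> R) : Prop :=
  forall r s e : R, 0 < r -> r <= s -> 0 < e <= 2 -> eta s e <= eta r e.

Definition nonexpansive (R : realType) (X : metricType R) (C : set X)
    (T : X -> X) : Prop :=
  forall x y : X, C x -> C y -> mdist (T x) (T y) <= mdist x y.

Fixpoint ishikawa (R : realType) (X : metricType R) (W : X -> X -> R -> X)
    (T : X -> X) (lam s : R^nat) (x : X) (n : nat) : X :=
  if n is m.+1 then
    let xm := ishikawa W T lam s x m in
    W xm (T (W xm (T xm) (s m))) (lam m)
  else x.

Definition distances (R : realType) (X : metricType R) (C : set X) : set R :=
  [set mdist x y | x in C & y in C].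

Definition metric_bounded (R : realType) (X : metricType R) (C : set X) : Prop :=
  has_ubound (distances C).

Definition diameter (R : realType) (X : metricType R) (C : set X) : R :=
  sup (distances C).

(* [series a n] sums the terms of index < n, hence the successors below. *)
Definition rate_of_divergence (R : realType) (a : R^nat) (theta : nat -> nat)
    : Prop :=
  ~ cvgn (series a) /\ forall n : nat, n%:R <= series a (theta n).+1.

Definition cauchy_modulus (R : realType) (a : R^nat) (gamma : R -> nat) : Prop :=
  cvgn (series a) /\
  forall (e : R) (n : nat), 0 < e ->
    `|series a (gamma e + n).+1 - series a (gamma e).+1| < e.

(* The argument of the ceiling is positive whenever e, d > 0, 1 <= L and eta is
   a modulus of uniform convexity, so [absz] just reads the integer as a nat. *)
Definition Phi (R : realType) (e : R) (eta : R -> R -> R) (d : R)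
    (theta : nat -> nat) (L N0 : nat) (gamma : R -> nat) : nat :=
  if e <= 4 * L%:R * d then
    theta (absz (Num.ceil (2 * L%:R * (d + 1) /
                           (e * eta d (e / (2 * L%:R * d)))))
           + gamma (e / (8 * d)) + N0 + 1)%N
  else (gamma (e / (8 * d)) + N0 + 1)%N.

(* Main.v *)
(* Each step of the iteration brings [x_n] closer to any fixed point, by an
   amount controlled by [lam n * (1 - lam n)] and uniform convexity as long as
   [d (x_n, T x_n)] is large; divergence of the series therefore produces one
   index with a small residual.  The residual grows by a factor of at most
   [1 + 2 s_n (1 - lam n)] per step, and the Cauchy modulus then keeps it small
   from that index on.  Exact fixed points, hence completeness, are avoided:
   iterating the contraction [y |-> W c (T y) t] with [t] close to 1 gives
   arbitrarily good approximate fixed points, which suffice because only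
   finitely many steps are compared. *)

Require Import Defs.
From HB Require Import structures.
From mathcomp Require Import all_boot all_order all_algebra.
From mathcomp Require Import all_classical all_reals all_analysis.
From mathcomp Require Import ring lra.

Set Implicit Arguments.
Unset Strict Implicit.
Unset Printing Implicit Defensive.

Import Order.TTheory GRing.Theory Num.Theory.
Import numFieldNormedType.Exports.

Local Open Scope classical_set_scope.
Local Open Scope ring_scope.

(** * Distances along segments *)

Section Hyperbolic.
Context (R : realType) (X : metricType R) (W : X -> X -> R -> X).
Hypothesis W_hyp : W_hyperbolic W.

(** Makes an endpoint a point of its segment, so that [W_dist_param] measures distances from it. *)
Lemma W_at0 (x y : X) : W x y 0 = x.
Proof.
have /= := W_dist_le W_hyp x y x (l := 0).
rewrite lexx ler01 mdistxx mulr0 mul0r addr0 => /(_ isT) dist_le0.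
by apply/esym/mdist_positivity/eqP; rewrite eq_le dist_le0 mdist_ge0.
Qed.

Lemma mdist_Wl (x y : X) (l : R) : 0 <= l <= 1 ->
  mdist x (W x y l) = l * mdist x y.
Proof.
move=> l01; rewrite -{1}(W_at0 x y) (W_dist_param W_hyp) ?lexx ?ler01//.
by rewrite sub0r normrN ger0_norm//; case/andP: l01.
Qed.

Lemma mdist_Wr (x y : X) (l : R) : 0 <= l <= 1 ->
  mdist (W x y l) y = (1 - l) * mdist x y.
Proof.
move=> l01; rewrite (W_sym W_hyp)// metric_sym mdist_Wl; last by lra.
by rewrite (metric_sym x).
Qed.

Lemma mdist_W_le (x y z : X) (l : R) : 0 <= l <= 1 ->
  mdist (W x y l) z <= (1 - l) * mdist x z + l * mdist y z.
Proof.
move=> l01; rewrite metric_sym (metric_sym x) (metric_sym y).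
exact: (W_dist_le W_hyp).
Qed.

(** * Strict convexity and the modulus at arbitrary parameters *)

Section UniformlyConvex.
Variable eta : R -> R -> R.
Hypothesis eta_modulus : modulus_of_uniform_convexity W eta.

(** The modulus is applied at [mdist x y / r], which the triangle inequality through [a] keeps at
    most 2. *)
Lemma mdist_midpoint_lt (x y a : X) (r : R) : x != y ->
  mdist x a <= r -> mdist y a <= r -> mdist (W x y 2^-1) a < r.
Proof.
rewrite -mdist_gt0 => xy_gt0 xa ya.
have xy_le : mdist x y <= 2 * r.
  have := metric_triangle x a y; rewrite (metric_sym a y); lra.
have r_gt0 : 0 < r by lra.
have e_bounds : 0 < mdist x y / r <= 2.
  by rewrite divr_gt0//= ler_pdivrMr.
case: eta_modulus => eta_pos eta_uc.
have /andP[eta_gt0 _] := eta_pos _ _ r_gt0 e_bounds.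
have /(_ a x y xa ya) := eta_uc _ _ _ _ _ r_gt0 e_bounds.
rewrite divfK ?gt_eqF// => /(_ (lexx _)) /le_lt_trans; apply.
by rewrite gtr_pMl// ltrBlDr ltrDl.
Qed.

(** The midpoint of two distinct candidates would be strictly closer to both [x] and [y],
    contradicting the triangle inequality. *)
Lemma geodesic_point_unique (x y z u : X) (l : R) :
  mdist z x <= l * mdist x y -> mdist z y <= (1 - l) * mdist x y ->
  mdist u x <= l * mdist x y -> mdist u y <= (1 - l) * mdist x y ->
  z = u.
Proof.
move=> zx zy ux uy; apply/eqP; apply/negPn/negP => zu.
have := mdist_midpoint_lt zu zx ux; have := mdist_midpoint_lt zu zy uy.
have := metric_triangle x (W z u 2^-1) y; rewrite (metric_sym x (W _ _ _)).
lra.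
Qed.

Lemma W_midpoint (x y : X) (l : R) : 0 <= l <= 2^-1 ->
  W x (W x y 2^-1) (2 * l) = W x y l.
Proof.
move=> l_half.
have half01 : 0 <= (2^-1 : R) <= 1 by lra.
have l01 : 0 <= l <= 1 by lra.
have l2 : 0 <= 2 * l <= 1 by lra.
apply: (@geodesic_point_unique x y _ _ l).
- by rewrite metric_sym mdist_Wl// mdist_Wl//; lra.
- apply: le_trans (mdist_W_le _ _ _ l2) _; rewrite mdist_Wr//; lra.
- by rewrite metric_sym mdist_Wl.
- by rewrite mdist_Wr.
Qed.

(** By symmetry [l <= 1/2]. The point then lies on the segment from [x] to the midpoint, at
    parameter [2 * l], so the gain at the midpoint is scaled by [2 * l]. Weakening this to
    [2 * l * (1 - l)] makes the bound symmetric. *)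
Lemma mdist_W_uniformly_convex (x y a : X) (r e l : R) :
  0 < r -> 0 < e <= 2 -> 0 <= l <= 1 ->
  mdist x a <= r -> mdist y a <= r -> e * r <= mdist x y ->
  mdist (W x y l) a <= (1 - 2 * (l * (1 - l)) * eta r e) * r.
Proof.
move=> r_gt0 e02.
case: eta_modulus => /(_ _ _ r_gt0 e02)/andP[eta_gt0 _] eta_uc.
wlog l_half : x y l / l <= 2^-1.
  move=> half_case l01 xa ya xy; have [/half_case|l_gt] := leP l 2^-1; first exact.
  rewrite (W_sym W_hyp)// (_ : l * _ = (1 - l) * (1 - (1 - l))); last by ring.
  by apply: half_case => //; rewrite 1?metric_sym//; lra.
move=> l01 xa ya xy.
have l2 : 0 <= 2 * l <= 1 by lra.
have mid := eta_uc _ _ a x y r_gt0 e02 xa ya xy.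
rewrite -W_midpoint; last by lra.
apply: le_trans (mdist_W_le _ _ _ l2) _.
have : (1 - 2 * l) * mdist x a <= (1 - 2 * l) * r by apply: ler_wpM2l => //; lra.
have : 2 * l * mdist (W x y 2^-1) a <= 2 * l * ((1 - eta r e) * r).
  by apply: ler_wpM2l => //; lra.
have : 0 <= l * l * (eta r e * r) by rewrite !mulr_ge0//; lra.
lra.
Qed.

End UniformlyConvex.

(** * Approximate fixed points of a nonexpansive map *)

Section Nonexpansive.
Variables (C : set X) (T : X -> X).
Hypotheses (C_convex : W_convex W C) (T_nonexpansive : nonexpansive C T).
Hypothesis T_fun : set_fun C C T.

Lemma approximate_fixed_point (c : X) (D delta : R) : C c ->
  (forall x y, C x -> C y -> mdist x y <= D) -> 0 < delta ->
  exists2 p, C p & mdist p (T p) <= delta.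
Proof.
move=> Cc C_le delta_gt0.
have D_ge0 : 0 <= D by rewrite (le_trans (mdist_ge0 c c))// C_le.
have D1 : 0 < 2 * D + delta by lra.
(* Chosen so that [(1 - t) * D <= delta / 2], with [t < 1] even when [D = 0]. *)
pose t := 2 * D / (2 * D + delta).
have t01 : 0 <= t <= 1.
  by apply/andP; split; [rewrite divr_ge0//; lra | rewrite ler_pdivrMr//; lra].
have t_lt1 : t < 1 by rewrite ltr_pdivrMr//; lra.
have t_norm : `|t| < 1 by rewrite ger0_norm//; case/andP: t01.
pose z := fix z n := if n is m.+1 then W c (T (z m)) t else c.
have Cz n : C (z n) by elim: n => //= n Cn; apply: C_convex => //; exact: T_fun.
have z_step n : mdist (z n.+1) (z n) <= t ^+ n * D.
  elim: n => [|n IHn]; first by rewrite expr0 mul1r C_le.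
  rewrite exprS -mulrA; apply: le_trans (W_dist_W W_hyp _ _ _ _ t01) _.
  rewrite mdistxx mulr0 add0r ler_wpM2l//; first by lra.
  exact: le_trans (T_nonexpansive _ _) IHn.
have [k tk] : exists k, t ^+ k * D <= delta / 2.
  have /cvgrPdist_lt/(_ (delta / (2 * (D + 1)))) := cvg_expr t_norm.
  case=> [|k _ /(_ k (leqnn k))/=]; first by rewrite divr_gt0//; lra.
  rewrite sub0r normrN ger0_norm ?exprn_ge0//; last by lra.
  move=> tk; exists k.
  have : t ^+ k * (2 * (D + 1)) < delta by rewrite -ltr_pdivlMr//; lra.
  have : 0 <= t ^+ k by rewrite exprn_ge0//; lra.
  lra.
(* Half of [delta] pays for the move from [z k] to [z k.+1], the other half for the distance from
   [z k.+1] to [T (z k)]. *)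
exists (z k) => //.
apply: le_trans (metric_triangle _ (z k.+1) _) _.
have zT : mdist (z k.+1) (T (z k)) = (1 - t) * mdist c (T (z k)) by rewrite mdist_Wr.
have : (1 - t) * mdist c (T (z k)) <= (1 - t) * D.
  by rewrite ler_wpM2l ?C_le//; [lra | exact: T_fun].
have : (1 - t) * D <= delta / 2.
  rewrite (_ : (1 - t) * D = delta * (D / (2 * D + delta))); last first.
    by rewrite /t; field; rewrite gt_eqF.
  by rewrite ler_pM2l// ler_pdivrMr//; lra.
rewrite (metric_sym (z k)); have := z_step k; lra.
Qed.

(** * One step of the Ishikawa iteration *)

Section Step.
Variables (x : X) (s l : R).
Hypotheses (Cx : C x) (s01 : 0 <= s <= 1) (l01 : 0 <= l <= 1).
Let y := W x (T x) s.
Let x' := W x (T y) l.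

Let Cy : C y. Proof. by apply: C_convex => //; exact: T_fun. Qed.
Let Cx' : C x'. Proof. by apply: C_convex => //; exact: T_fun. Qed.

(** Going through [T y], the residual of [x'] is at most [(1 - l) * mdist x (T y) + mdist y x']. In
    units of [mdist x (T x)] these terms are at most [(1 - l) * (1 + s)] and [(1 - l) * s + l]. *)
Lemma ishikawa_step_residual :
  mdist x' (T x') <= (1 + 2 * (s * (1 - l))) * mdist x (T x).
Proof.
have l_le1 : l <= 1 by case/andP: l01.
have xy : mdist x y = s * mdist x (T x) by rewrite mdist_Wl.
have yTx : mdist y (T x) = (1 - s) * mdist x (T x) by rewrite mdist_Wr.
have TxTy : mdist (T x) (T y) <= mdist x y by exact: T_nonexpansive.
have xTy := metric_triangle x (T x) (T y).
have yTy : mdist (T y) y <= mdist x (T x).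
  have := metric_triangle (T y) (T x) y.
  by rewrite (metric_sym (T y) (T x)) (metric_sym (T x) y); lra.
have x'y : mdist x' y <= (1 - l) * mdist x y + l * mdist x (T x).
  apply: le_trans (mdist_W_le _ _ _ l01) _.
  by rewrite lerD2l ler_wpM2l//; case/andP: l01.
have x'Ty : mdist x' (T y) = (1 - l) * mdist x (T y) by rewrite mdist_Wr.
have : (1 - l) * mdist x (T y) <= (1 - l) * ((1 + s) * mdist x (T x)).
  by rewrite ler_wpM2l//; lra.
have := T_nonexpansive Cy Cx'; rewrite (metric_sym y).
have := metric_triangle x' (T y) (T x').
rewrite x'Ty; rewrite xy in x'y; lra.
Qed.

(** Turns a large residual into a separation of [x] and [T y], the endpoints of the segment carrying
    [x'], provided [s] stays away from 1. *)
Lemma ishikawa_inner_residual :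
  (1 - s) * mdist x (T x) <= mdist x (T y).
Proof.
have := metric_triangle x (T y) (T x).
have := T_nonexpansive Cy Cx; rewrite (metric_sym y) mdist_Wl//; lra.
Qed.

Variables (eta : R -> R -> R) (D : R).
Hypotheses (eta_modulus : modulus_of_uniform_convexity W eta)
  (eta_monotone : monotone_modulus eta).
Hypothesis C_le : forall a b, C a -> C b -> mdist a b <= D.

(* The radius [min (mdist x p + 2 delta) D] keeps the monotone modulus
   evaluated at radii at most [D], although [p] is only nearly fixed. *)
Lemma ishikawa_step_decrease (p : X) (delta e : R) : C p ->
  mdist p (T p) <= delta -> 0 < D -> 0 < e <= 2 -> e * D <= mdist x (T y) ->
  mdist x' p <= mdist x p + 2 * delta - l * (1 - l) * (eta D e * (e * D)).
Proof.
move=> Cp p_fix D_gt0 e02 e_le.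
have [s_ge0 s_le1] := andP s01; have [l_ge0 l_le1] := andP l01.
have delta_ge0 : 0 <= delta by apply: le_trans (mdist_ge0 p (T p)) p_fix.
have TxTp := T_nonexpansive Cx Cp.
have TyTp := T_nonexpansive Cy Cp.
have yp : mdist y p <= mdist x p + delta.
  have Txp : mdist (T x) p <= mdist x p + delta.
    by have := metric_triangle (T x) (T p) p; rewrite (metric_sym (T p)); lra.
  apply: le_trans (mdist_W_le _ _ _ s01) _.
  have : s * mdist (T x) p <= s * (mdist x p + delta).
    by rewrite ler_wpM2l//; lra.
  have : 0 <= (1 - s) * delta by rewrite mulr_ge0//; lra.
  lra.
have Typ : mdist (T y) p <= mdist x p + 2 * delta.
  by have := metric_triangle (T y) (T p) p; rewrite (metric_sym (T p)); lra.
pose r := Num.min (mdist x p + 2 * delta) D.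
have r_leD : r <= D by rewrite ge_min lexx orbT.
have r_le : r <= mdist x p + 2 * delta by rewrite ge_min lexx.
have xp_le : mdist x p <= r by rewrite le_min C_le// lerDl mulr_ge0.
have Typ_le : mdist (T y) p <= r by rewrite le_min Typ C_le//; exact: T_fun.
have xTy_le : mdist x (T y) <= 2 * r.
  by have := metric_triangle x p (T y); rewrite (metric_sym p); lra.
have eD_gt0 : 0 < e * D by rewrite mulr_gt0//; lra.
have r_gt0 : 0 < r by lra.
have er_le : e * r <= mdist x (T y).
  by apply: le_trans e_le; rewrite ler_wpM2l//; lra.
apply: le_trans (mdist_W_uniformly_convex eta_modulus r_gt0 e02 l01
                   xp_le Typ_le er_le) _.
have eta_le := eta_monotone r_gt0 r_leD e02.
case: eta_modulus => /(_ _ _ D_gt0 e02)/andP[eta_gt0 _] _.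
(* Since [e * D <= mdist x (T y) <= 2 * r], the factor 2 of the convexity estimate trades the
   unknown radius [r] for [D]. *)
have : eta D e * (e * D) <= eta r e * (2 * r) by apply: ler_pM => //; lra.
have ll_ge0 : 0 <= l * (1 - l) by rewrite mulr_ge0//; lra.
move/(ler_wpM2l ll_ge0); lra.
Qed.

End Step.

(** * Summing the one-step estimates *)

Section Iteration.
Variables (lam s : R^nat) (x : X) (D : R).
Hypotheses (lam01 : forall n, 0 <= lam n <= 1) (s01 : forall n, 0 <= s n <= 1).
Hypotheses (Cx : C x) (C_le : forall a b, C a -> C b -> mdist a b <= D).
Let x_ := ishikawa W T lam s x.

Lemma ishikawa_in (n : nat) : C (x_ n).
Proof.
elim: n => //= n Cn.
by do 2?[apply: C_convex => //; apply: T_fun => //].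
Qed.

(** Bounding the residual by [D] in the growth term makes the multiplicative growth additive, and
    the increments sum up. *)
Lemma ishikawa_residual_tail (m n : nat) : (m <= n)%N ->
  mdist (x_ n) (T (x_ n)) <= mdist (x_ m) (T (x_ m)) +
    2 * D * (series (fun k => s k * (1 - lam k)) n -
             series (fun k => s k * (1 - lam k)) m).
Proof.
elim: n => [|n IHn]; first by rewrite leqn0 => /eqP->; rewrite subrr mulr0 addr0.
rewrite leq_eqVlt => /predU1P[->|]; first by rewrite subrr mulr0 addr0.
rewrite ltnS => /IHn tail; rewrite seriesSr.
have step := ishikawa_step_residual (ishikawa_in n) (s01 n) (lam01 n).
have [[s_ge0 _] [_ l_le1]] := (andP (s01 n), andP (lam01 n)).
have res_le : mdist (x_ n) (T (x_ n)) <= D.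
  by apply: C_le; [|apply: T_fun]; exact: ishikawa_in.
have sl_ge0 : 0 <= s n * (1 - lam n) by rewrite mulr_ge0// subr_ge0.
have sD := ler_wpM2l sl_ge0 res_le; rewrite -/(x_ n) in step.
by apply: le_trans step _; lra.
Qed.

Variable eta : R -> R -> R.
Hypotheses (eta_modulus : modulus_of_uniform_convexity W eta)
  (eta_monotone : monotone_modulus eta).

(** The distance to a nearly fixed point starts at most [D] and stays nonnegative, so the total
    decrease cannot exceed [D] plus the accumulated errors, which are arbitrarily small. *)
Lemma ishikawa_divergence_bound (e : R) (m n : nat) :
  0 < D -> 0 < e <= 2 -> (m <= n)%N ->
  (forall k, (m <= k < n)%N ->
     e * D <= mdist (x_ k) (T (W (x_ k) (T (x_ k)) (s k)))) ->
  (series (fun k => lam k * (1 - lam k)) n -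
   series (fun k => lam k * (1 - lam k)) m) * (eta D e * (e * D)) <= D.
Proof.
move=> D_gt0 e02 mn e_le; apply/ler_addgt0Pr => d d_gt0.
(* At most [n] steps each lose [2 * delta], for a total of at most [d]; the successor covers
   [n = 0]. *)
have delta_gt0 : 0 < d / (2 * n.+1%:R) by rewrite divr_gt0.
have [p Cp p_fix] := approximate_fixed_point Cx C_le delta_gt0.
set delta := d / _ in delta_gt0 p_fix.
pose S := series (fun k => lam k * (1 - lam k)).
have decrease k : (m <= k <= n)%N ->
    mdist (x_ k) p + (S k - S m) * (eta D e * (e * D)) <= D + 2 * delta * k%:R.
  elim: k => [|k IHk].
    rewrite leqn0 => /andP[/eqP-> _]; rewrite subrr mul0r mulr0 !addr0.
    exact: C_le.
  case/andP; rewrite leq_eqVlt => /predU1P[<- _|mk kn].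
    rewrite subrr mul0r addr0 ler_wpDr//.
      by rewrite mulr_ge0// mulr_ge0// ltW.
    by apply: C_le => //; exact: ishikawa_in.
  have := ishikawa_step_decrease (ishikawa_in k) (s01 k) (lam01 k)
    eta_modulus eta_monotone C_le Cp p_fix D_gt0 e02.
  have := IHk; rewrite -ltnS mk ltnW// => /(_ isT) prev.
  have := e_le k; rewrite -ltnS mk kn => /(_ isT) /[swap] /[apply].
  rewrite /S seriesSr -/(S k) -/(S m) -[k.+1%:R]natr1 -/(x_ k.+1); lra.
have := decrease n; rewrite mn leqnn => /(_ isT).
have : 2 * delta * n%:R <= d.
  rewrite (_ : _ * _ = d * (n%:R / n.+1%:R)); last first.
    by rewrite /delta; field; rewrite nat1r pnatr_eq0.
  by rewrite ler_piMr ?(ltW d_gt0)// ler_pdivrMr// mul1r ler_nat.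
have := mdist_ge0 (x_ n) p; rewrite -/(S n) -/(S m); lra.
Qed.

End Iteration.

End Nonexpansive.

End Hyperbolic.

(** * The explicit rate and the limit *)

Lemma series_le_natr (R : realType) (u : R^nat) (n : nat) :
  (forall k, u k <= 1) -> series u n <= n%:R.
Proof.
move=> u_le1; elim: n => [|n IHn]; first by rewrite /series/= big_geq.
by rewrite seriesSr -natr1 lerD.
Qed.

Theorem corollary4p9 (R : realType) (X : completeMetricType R)
  (W : X -> X -> R -> X) (W_hyp : W_hyperbolic W)
  (eta : R -> R -> R) (eta_modulus : modulus_of_uniform_convexity W eta)
  (eta_monotone : monotone_modulus eta)
  (C : set X) (C_nonempty : C !=set0) (C_convex : W_convex W C)
  (C_closed : closed C) (C_bounded : metric_bounded C)
  (T : {fun C >-> C}) (T_nonexpansive : nonexpansive C T)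
  (lam s : R^nat)
  (lam01 : forall n : nat, 0 <= lam n <= 1)
  (s01 : forall n : nat, 0 <= s n <= 1)
  (theta : nat -> nat)
  (theta_rate : rate_of_divergence (fun n : nat => lam n * (1 - lam n)) theta)
  (s_limsup : limn_sup s < 1)
  (L N0 : nat) (L_ge1 : (1 <= L)%N)
  (s_le : forall n : nat, (N0 <= n)%N -> s n <= 1 - 1 / L%:R)
  (gamma : R -> nat)
  (gamma_modulus : cauchy_modulus (fun n : nat => s n * (1 - lam n)) gamma) :
  (forall x : X, C x ->
     mdist (ishikawa W T lam s x n) (T (ishikawa W T lam s x n))
       @[n --> \oo] --> (0 : R)) /\
  (0 < diameter C ->
   forall x : X, C x ->
   forall e : R, 0 < e ->
   forall n : nat, (Phi e eta (diameter C) theta L N0 gamma <= n)%N ->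
     mdist (ishikawa W T lam s x n) (T (ishikawa W T lam s x n)) < e).
Proof.
have L_gt0 : 0 < (L%:R : R) by rewrite ltr0n.
have L_ge1R : 1 <= (L%:R : R) by rewrite ler1n.
have T_fun : set_fun C C T by exact: funS.
have C_le a b : C a -> C b -> mdist a b <= diameter C.
  by move=> Ca Cb; apply: ub_le_sup => //; exists a => //; exists b.
have rate : 0 < diameter C -> forall x, C x -> forall e, 0 < e -> forall n,
    (Phi e eta (diameter C) theta L N0 gamma <= n)%N ->
    mdist (ishikawa W T lam s x n) (T (ishikawa W T lam s x n)) < e.
  set D := diameter C => D_gt0 x Cx e e_gt0 n.
  have in_C := ishikawa_in C_convex T_fun lam01 s01 Cx.
  rewrite /Phi; case: ifPn => [e_le|]; last first.
    (* Here [e > 4 * L * D >= D], so every residual is below [e]. *)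
    rewrite -ltNge => e_gt _; apply: le_lt_trans (C_le _ _ _ (T_fun _ _)) _ => //.
    rewrite -/D; apply: le_lt_trans e_gt; rewrite ler_peMl ?(ltW D_gt0)//.
    by rewrite (le_trans L_ge1R)// ler_peMl ?ler1n// ltW.
  set K := 2 * _ * _ / _; set e' := e / _ in K *.
  set M := (gamma (e / (8 * D)) + N0 + 1)%N.
  (* The case condition [e <= 4 * L * D] says precisely that [e' <= 2]. *)
  have e'_bounds : 0 < e' <= 2.
    by rewrite divr_gt0 ?mulr_gt0//= ler_pdivrMr ?mulr_gt0//; lra.
  have [eta_pos _] := eta_modulus.
  have /andP[eta_gt0 _] := eta_pos _ _ D_gt0 e'_bounds.
  have K_gt0 : 0 < K by rewrite divr_gt0 ?mulr_gt0//; lra.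
  have -> : (`|Num.ceil K| + gamma (e / (8 * D)) + N0 + 1 = `|Num.ceil K| + M)%N.
    by rewrite /M !addnA.
  set N := theta _ => N_le.
  pose S := series (fun k => lam k * (1 - lam k)).
  have S_large : `|Num.ceil K|%:R + M%:R <= S N.+1.
    by rewrite -natrD; exact: theta_rate.2.
  (* The first [M] terms contribute at most [M], so at least [K] remains for the indices from [M] to
     [N]. *)
  have S_le k : S k <= k%:R.
    apply: series_le_natr => j; have /andP[l_ge0 l_le1] := lam01 j.
    by rewrite mulr_ile1// ?subr_ge0// lerBlDr lerDl.
  have K_le : K <= `|Num.ceil K|%:R.
    by rewrite natr_absz ger0_norm ?ceil_ge// ceil_ge0 (lt_trans _ K_gt0).
  have MN : (M <= N.+1)%N.
    by rewrite -(ler_nat R); have := S_le N.+1; lra.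
  have [k /andP[Mk kN] res_k] : exists2 k, (M <= k < N.+1)%N &
      mdist (ishikawa W T lam s x k) (T (ishikawa W T lam s x k)) < e / 2.
    (* Otherwise [mdist x_k (T y_k) >= e / (2 * L) = e' * D] at all these indices, and the decrease,
       bounded by [D], would be at least [K * (eta D e' * (e' * D)) = D + 1]. *)
    apply: contrapT => no_small.
    have : (S N.+1 - S M) * (eta D e' * (e' * D)) <= D.
      apply: (ishikawa_divergence_bound W_hyp C_convex T_nonexpansive T_fun
                lam01 s01 Cx C_le eta_modulus eta_monotone) => // k MkN.
      apply: le_trans (ishikawa_inner_residual W_hyp C_convex T_nonexpansive
                         T_fun (in_C k) (s01 k)).
      have res_k : e / 2 <= mdist (ishikawa W T lam s x k)
                                  (T (ishikawa W T lam s x k)).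
        by rewrite leNgt; apply/negP => res_k; apply: no_small; exists k.
      have sk : L%:R^-1 <= 1 - s k.
        have /s_le : (N0 <= k)%N.
          by case/andP: MkN => /(leq_trans _)->//; rewrite /M addnAC leq_addl.
        by rewrite div1r; lra.
      rewrite (_ : e' * D = L%:R^-1 * (e / 2)); last first.
        by rewrite /e'; field; rewrite !gt_eqF.
      by apply: ler_pM; rewrite // ?invr_ge0 ?divr_ge0 ?(ltW e_gt0).
    have e'D_gt0 : 0 < eta D e' * (e' * D).
      by rewrite mulr_gt0 ?eta_gt0// mulr_gt0 ?(andP e'_bounds).1.
    have : K * (eta D e' * (e' * D)) <= (S N.+1 - S M) * (eta D e' * (e' * D)).
      by rewrite ler_pM2r//; have := S_le M; lra.
    have -> : K * (eta D e' * (e' * D)) = D + 1.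
      rewrite (_ : e' * D = e / (2 * L%:R)); last first.
        by rewrite /e'; field; rewrite !gt_eqF.
      by rewrite /K; move: (eta D e') eta_gt0 => h h_gt0; field; rewrite !gt_eqF.
    lra.
  have kn : (k <= n)%N by apply: leq_trans N_le; rewrite -ltnS.
  have := ishikawa_residual_tail W_hyp C_convex T_nonexpansive T_fun lam01 s01
            Cx C_le kn.
  pose s_lam := fun j => s j * (1 - lam j); rewrite -/s_lam -/D.
  have gk : ((gamma (e / (8 * D))).+1 <= k)%N.
    by apply: leq_trans Mk; rewrite /M addn1 ltnS leq_addr.
  have s_lam_ge0 j : 0 <= s_lam j.
    have [/andP[s_ge0 _] /andP[_ l_le1]] := (s01 j, lam01 j).
    by rewrite mulr_ge0// subr_ge0.
  have gamma_k : series s_lam (gamma (e / (8 * D))).+1 <= series s_lam k.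
    by apply: (nondecreasing_series (P := xpredT)) => // j _ _.
  (* After index [k] the residual grows by less than [2 * D * (e / (8 * D)) = e / 4], so it stays
     below [e / 2 + e / 4]. *)
  have : series s_lam n - series s_lam (gamma (e / (8 * D))).+1 < e / (8 * D).
    have := gamma_modulus.2 (e / (8 * D)) (n - (gamma (e / (8 * D))).+1)%N.
    rewrite -addSn subnKC ?(leq_trans gk kn)//.
    have e8_gt0 : 0 < e / (8 * D) by rewrite divr_gt0// mulr_gt0.
    by move=> /(_ e8_gt0); apply: le_lt_trans; exact: ler_norm.
  rewrite ltr_pdivlMr ?mulr_gt0// => tail_lt res_n.
  have : (series s_lam n - series s_lam k) * D <=
         (series s_lam n - series s_lam (gamma (e / (8 * D))).+1) * D.
    by rewrite ler_pM2r//; lra.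
  lra.
split=> // x Cx.
have in_C := ishikawa_in C_convex T_fun lam01 s01 Cx.
apply/cvgrPdist_lt => e e_gt0.
have [D_gt0|D_le0] := ltP 0 (diameter C).
  near=> n; rewrite sub0r normrN ger0_norm ?mdist_ge0//.
  apply: rate => //; near: n; exact: nbhs_infty_ge.
(* With a diameter that is not positive, all distances in [C] vanish. *)
near=> n; rewrite sub0r normrN ger0_norm ?mdist_ge0//.
apply: le_lt_trans e_gt0; apply: le_trans D_le0.
by apply: C_le; [|apply: T_fun]; exact: in_C.
Unshelve. all: by end_near.
Qed.
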